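(* For any $n\ge 1$, $$\sum_{\pi \in \mathfrak{S}_n} (-1)^{\mathrm{inv}(\pi)}\, \mathbf{x}_{\mathrm{RLMv}(\pi)} = \Big(\prod_{\substack{i \in [n] \\ i \text{ odd}}} x_i\Big)\Big(\prod_{\substack{j \in [n] \\ j \text{ even}}} (x_j-1)\Big).$$ In particular, for any $k=1,\dots,n$, $$|\{ \pi \in \mathfrak{S}^e_n : \mathrm{rlm}(\pi)=k \}| - |\{ \pi \in \mathfrak{S}^o_n : \mathrm{rlm}(\pi)=k \}| = (-1)^{n-k}\binom{ \lfloor n/2 \rfloor }{k - \lceil n/2 \rceil}.$$
   Context: $[n]=\{1,\dots,n\}$; $\mathfrak{S}_n$ is the symmetric group on $[n]$, with $\mathfrak{S}_n^e$ and $\mathfrak{S}_n^o$ the sets of even and odd permutations. For $\pi\in\mathfrak{S}_n$: $\mathrm{inv}(\pi)$ is the number of pairs $i<j$ with $\pi(i)>\pi(j)$; $\mathrm{RLMi}(\pi)=\{i\in[n]:\pi(i)<\pi(j)\text{ for all }j\in\{i+1,\dots,n\}\}$; $\mathrm{RLMv}(\pi)=\{\pi(i):i\in\mathrm{RLMi}(\pi)\}$; $\mathrm{rlm}(\pi)=|\mathrm{RLMv}(\pi)|$. $x_1,\dots,x_n$ are commuting indeterminates and $\mathbf{x}_S=\prod_{s\in S}x_s$. Binomial coefficients $\binom{a}{b}$ with $b<0$ or $b>a$ are $0$. *)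

(* Defs.v *)
From mathcomp Require Import all_boot all_order all_fingroup all_algebra.
From mathcomp Require Import mpoly.

Set Implicit Arguments.
Unset Strict Implicit.
Unset Printing Implicit Defensive.

Import GRing.Theory.
Local Open Scope ring_scope.

(* Permutations of [n] = {1, ..., n} are elements of 'S_n, where the ordinal
   i : 'I_n stands for the integer i.+1 of [n]; this shift preserves the order,
   but parity conditions on elements of [n] must be tested on i.+1. *)

Definition invcount (n : nat) (s : 'S_n) : nat :=
  #|[set p : 'I_n * 'I_n | (p.1 < p.2)%N && (s p.2 < s p.1)%N]|.

Definition RLMi (n : nat) (s : 'S_n) : {set 'I_n} :=
  [set i : 'I_n | [forall j : 'I_n, (i < j)%N ==> (s i < s j)%N]].

Definition RLMv (n : nat) (s : 'S_n) : {set 'I_n} := [set s i | i in RLMi s].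

Definition rlm (n : nat) (s : 'S_n) : nat := #|RLMv s|.

Definition xset (n : nat) (S : {set 'I_n}) : {mpoly int[n]} :=
  \prod_(i in S) 'X_i.

(* Binomial coefficient with an integer lower index, zero when that index is
   negative. *)
Definition zbinom (a : nat) (b : int) : nat :=
  if b is Posz m then 'C(a, m) else 0%N.

(* Main.v *)
Require Import Defs.
From mathcomp Require Import all_boot all_order all_fingroup all_algebra.
From mathcomp Require Import mpoly.

Set Implicit Arguments.
Unset Strict Implicit.
Unset Printing Implicit Defensive.

Import GRing.Theory.
Local Open Scope ring_scope.

(** Deleting the largest value from a permutation of [n.+1] found at
    (0-based) position [i] leaves a permutation of [n]. This removes [n - i]
    inversions, and it removes exactly one right-to-left minimum if [i = n] and
    none otherwise. So passing from [n] to [n.+1] multiplies the signed generating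
    function by [x_(n+1) + (-1)^1 + ... + (-1)^n], which is [x_(n+1)] for [n] even
    and [x_(n+1) - 1] for [n] odd. The signed count by [rlm] is read off the
    coefficients after setting all the indeterminates equal. *)

(** The position [i] is recovered as the place of the value [ord_max], then [s] from the other
    positions. Surjectivity follows by counting, since (n+1) * n! = (n+1)!. *)
Lemma lift_perm_max_bij (n : nat) :
  bijective (fun p : 'I_n.+1 * 'S_n => lift_perm p.1 ord_max p.2).
Proof.
apply: inj_card_bij => [[i s] [j t] /= e|]; last first.
  by rewrite card_prod card_ord !card_Sn.
have ij : i = j.
  apply: (@perm_inj _ (lift_perm i ord_max s)).
  by rewrite lift_perm_id e lift_perm_id.
congr pair => //; apply/permP => k; apply: (@lift_inj _ ord_max).
by rewrite -!(lift_perm_lift i) e ij.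
Qed.

Lemma sum_lift_perm_max (R : nmodType) (n : nat) (F : 'S_n.+1 -> R) :
  \sum_s F s = \sum_(i < n.+1) \sum_(s : 'S_n) F (lift_perm i ord_max s).
Proof.
rewrite (reindex _ (onW_bij _ (lift_perm_max_bij n))).
by rewrite [RHS]pair_bigA.
Qed.

Lemma ltn_lift (n : nat) (i : 'I_n.+1) (j k : 'I_n) :
  (lift i j < lift i k)%N = (j < k)%N.
Proof. by rewrite !ltnNge /= leq_bump2. Qed.

Lemma sum_ltn_lift (n : nat) (i : 'I_n.+1) :
  (\sum_(j < n) (i < lift i j))%N = (n - i)%N.
Proof.
rewrite -[RHS]muln1 -sum_nat_const_nat big_geq_mkord [RHS]big_mkcond /=.
apply: eq_bigr => j _; rewrite /= /bump.
case: (leqP i j) => [ij|ji]; first by rewrite add1n ltnS ij.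
by rewrite add0n ltnNge ltnW.
Qed.

Lemma invcountE (n : nat) (s : 'S_n) :
  invcount s = (\sum_(i < n) \sum_(j < n) ((i < j) && (s j < s i)))%N.
Proof.
by rewrite pair_bigA /invcount cardsE -sum1_card big_mkcond.
Qed.

(** The maximum is inverted with exactly the entries after it; [lift] is increasing, so all other
    pairs keep their order. *)
Lemma invcount_lift_perm_max (n : nat) (i : 'I_n.+1) (s : 'S_n) :
  invcount (lift_perm i ord_max s) = (n - i + invcount s)%N.
Proof.
have sumE (F : 'I_n.+1 -> nat) :
    (\sum_j F j = F i + \sum_(j < n) F (lift i j))%N by rewrite (bigD1_ord i).
rewrite !invcountE !sumE ltnn add0n; congr addn.
  rewrite -sum_ltn_lift; apply: eq_bigr => j _.
  by rewrite lift_perm_id lift_perm_lift lift_max /= ltn_ord andbT.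
apply: eq_bigr => j _; rewrite sumE lift_perm_id lift_perm_lift.
rewrite [(ord_max < _)%N]ltnNge leq_ord andbF add0n.
by apply: eq_bigr => k _; rewrite lift_perm_lift !ltn_lift.
Qed.

(** Inserting the maximum at [i] changes [odd_perm] by the parity of [i + n], which is also that of
    [n - i]. *)
Lemma odd_invcount (n : nat) (s : 'S_n) : odd (invcount s) = odd_perm s.
Proof.
elim: n s => [|n IH] s.
  have -> : s = 1%g by apply/permP => - [].
  by rewrite odd_perm1 invcountE big_ord0.
have [g _ gK] := lift_perm_max_bij n; rewrite -(gK s); case: (g s) => i t /=.
by rewrite invcount_lift_perm_max odd_lift_perm oddD oddB ?leq_ord // IH addbC
           [odd n (+) _]addbC addbC.
Qed.

Lemma RLMi_lift_perm_max (n : nat) (i : 'I_n.+1) (s : 'S_n) :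
  (i \in RLMi (lift_perm i ord_max s)) = (i == ord_max).
Proof.
rewrite inE lift_perm_id; apply/forallP/eqP => [h|-> j].
  apply/eqP; rewrite -val_eqE /= eqn_leq leq_ord /= leqNgt.
  by apply/negP => /(implyP (h ord_max)); rewrite ltnNge leq_ord.
by rewrite [(ord_max < j)%N]ltnNge leq_ord.
Qed.

(** A maximum inserted to the right of an entry cannot stop it from being a right-to-left
    minimum. *)
Lemma RLMi_lift_perm_lift (n : nat) (i : 'I_n.+1) (j : 'I_n) (s : 'S_n) :
  (lift i j \in RLMi (lift_perm i ord_max s)) = (j \in RLMi s).
Proof.
rewrite !inE; apply/forallP/forallP => h k.
  by have := h (lift i k); rewrite !lift_perm_lift !ltn_lift.
case: (unliftP i k) => [k'|] ->.
  by rewrite !lift_perm_lift !ltn_lift.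
by rewrite lift_perm_id lift_perm_lift lift_max /= ltn_ord implybT.
Qed.

Lemma prod_RLMv (R : comNzRingType) (n : nat) (F : 'I_n -> R) (s : 'S_n) :
  \prod_(v in RLMv s) F v = \prod_(i in RLMi s) F (s i).
Proof. by rewrite big_imset //=; apply: in2W; apply: perm_inj. Qed.

Lemma prod_RLMv_lift_perm_max (R : comNzRingType) (x : nat -> R) (n : nat)
    (i : 'I_n.+1) (s : 'S_n) :
  \prod_(v in RLMv (lift_perm i ord_max s)) x v
    = (if i == ord_max then x n else 1) * \prod_(v in RLMv s) x v.
Proof.
rewrite !prod_RLMv big_mkcond (bigD1_ord i) //= RLMi_lift_perm_max lift_perm_id.
congr (_ * _); rewrite [RHS]big_mkcond; apply: eq_bigr => j _.
by rewrite RLMi_lift_perm_lift lift_perm_lift lift_max.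
Qed.

(** The signs alternate and end in -1, so they cancel in pairs, except for a single -1 when [n] is
    odd. *)
Lemma sum_signs (R : comNzRingType) (n : nat) :
  \sum_(i < n) (-1) ^+ (n - i) = - (odd n)%:R :> R.
Proof.
elim: n => [|n IH]; first by rewrite big_ord0 oppr0.
rewrite big_ord_recl subn0 /= (eq_bigr (fun i : 'I_n => (-1) ^+ (n - i))) // IH.
by rewrite -signr_odd /=; case: odd; rewrite /= ?expr0 ?expr1 ?subrr ?subr0 ?oppr0.
Qed.

(** Weights indexed by [nat] serve every [n] at once, as the induction requires. Indices are
    0-based: odd [i] stands for an even element of [n]. *)
Lemma signed_RLMv_sum (R : comNzRingType) (x : nat -> R) (n : nat) :
  \sum_(s : 'S_n) (-1) ^+ invcount s * \prod_(v in RLMv s) x v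
    = \prod_(i < n) (x i - (odd i)%:R).
Proof.
elim: n => [|n IH].
  rewrite big_ord0 (big_pred1 1%g) => [|s]; last first.
    by apply/esym/eqP/permP => - [].
  by rewrite invcountE big_ord0 expr0 mul1r big1 // => - [].
(* The new factor [x n - (odd n)%:R] becomes one term per insertion position: a sign for each
   non-final one, [x n] for the last. *)
rewrite big_ord_recr /= -IH sum_lift_perm_max mulrC -sum_signs.
transitivity (\sum_(i < n.+1)
   ((-1) ^+ (n - i) * (if i == ord_max then x n else 1)) *
   \sum_(s : 'S_n) (-1) ^+ invcount s * \prod_(v in RLMv s) x v).
  apply: eq_bigr => i _; rewrite mulr_sumr; apply: eq_bigr => s _.
  by rewrite invcount_lift_perm_max prod_RLMv_lift_perm_max exprD mulrACA.
rewrite -mulr_suml; congr (_ * _); rewrite big_ord_recr /= eqxx subnn mul1r addrC.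
congr (_ + _); apply: eq_bigr => i _.
by rewrite -val_eqE /= ltn_eqF ?mulr1.
Qed.

Lemma signed_RLMv_mpoly (n : nat) :
  \sum_(s : 'S_n) (-1) ^+ invcount s * xset (RLMv s)
     = (\prod_(i < n | odd i.+1) 'X_i) * (\prod_(j < n | ~~ odd j.+1) ('X_j - 1))
     :> {mpoly int[n]}.
Proof.
(* The default 0 is never reached, as only indices below [n] occur. *)
pose x k : {mpoly int[n]} := if insub k is Some i then 'X_i else 0.
have xE (i : 'I_n) : x i = 'X_i by rewrite /x valK.
under eq_bigr => s _ do under [xset _]eq_bigr => i _ do rewrite -xE.
rewrite signed_RLMv_sum (bigID (fun i : 'I_n => odd i.+1)) /=.
by congr (_ * _); apply: eq_bigr => i; rewrite xE; case: odd; rewrite ?subr0.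
Qed.

Lemma signed_rlm_poly (n : nat) :
  \sum_(s : 'S_n) (-1) ^+ s * 'X^(rlm s)
    = 'X^(uphalf n) * ('X - 1) ^+ n./2 :> {poly int}.
Proof.
have := signed_RLMv_sum (fun=> 'X : {poly int}) n.
under eq_bigr => s _ do rewrite prodr_const -signr_odd odd_invcount.
move=> ->; elim: n => [|n IH]; first by rewrite big_ord0 !expr0 mulr1.
(* For odd [n] the new factor is ['X - 1] and the lower half grows; for even [n] it is ['X] and the
   upper half grows. *)
rewrite big_ord_recr /= {}IH uphalf_half; case: odd.
  by rewrite add1n -mulrA -exprSr.
by rewrite add0n subr0 mulrAC -exprSr.
Qed.

Lemma coef_Xsub1_exp (R : comNzRingType) (m k : nat) :
  (('X - 1) ^+ m : {poly R})`_k = (-1) ^+ (m - k) *+ 'C(m, k).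
Proof.
have -> : ('X - 1) ^+ m = \poly_(i < m.+1) ((-1) ^+ (m - i) *+ 'C(m, i)) :> {poly R}.
  rewrite addrC exprDn poly_def; apply: eq_bigr => i _.
  by rewrite -mul_polyC polyCMn polyC_exp polyCN polyC1 mulrnAl.
(* When [m < k] the subtraction [m - k] truncates, but the binomial is 0. *)
by rewrite coef_poly ltnS; case: leqP => // /bin_small ->.
Qed.

Theorem corollary36 (n : nat) (hn : (1 <= n)%N) :
  (\sum_(s : 'S_n) (-1) ^+ invcount s * xset (RLMv s)
     = (\prod_(i < n | odd i.+1) 'X_i) * (\prod_(j < n | ~~ odd j.+1) ('X_j - 1))
     :> {mpoly int[n]})
  /\
  (forall k : nat, (1 <= k <= n)%N ->
     (#|[set s : 'S_n | ~~ odd_perm s & rlm s == k]|)%:Z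
       - (#|[set s : 'S_n | odd_perm s & rlm s == k]|)%:Z
     = (-1) ^+ (n - k)%N * (zbinom n./2 (k%:Z - (uphalf n)%:Z))%:Z).
Proof.
split=> [|k /andP[_ kn]]; first exact: signed_RLMv_mpoly.
transitivity ((\sum_(s : 'S_n) (-1) ^+ s * 'X^(rlm s) : {poly int})`_k).
  have cardE (P : pred 'S_n) : (#|[set s | P s & rlm s == k]|)%:Z
      = \sum_(s | P s) (rlm s == k)%:R :> int.
    rewrite -natz cardsE -sum1_card natr_sum big_mkcondr.
    by apply: eq_bigr => s _; case: eqP.
  rewrite !cardE coef_sum [RHS](bigID (fun s : 'S_n => odd_perm s)) [LHS]addrC /=.
  rewrite -sumrN; congr (_ + _); apply: eq_bigr => s.
    by move=> ->; rewrite expr1 mulN1r coefN coefXn eq_sym.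
  by move=> /negbTE ->; rewrite expr0 mul1r coefXn eq_sym.
rewrite signed_rlm_poly coefXnM coef_Xsub1_exp.
have [lt_k|le_k] := ltnP.
  (* The coefficient is 0 here; the lower index is some [- d.+1], on which [zbinom] also
     vanishes. *)
  rewrite -opprB subzn ?(ltnW lt_k) //.
  by case: (uphalf n - k)%N (subn_gt0 k (uphalf n)) => [|d]; rewrite ?lt_k // mulr0.
(* This turns the exponent [n./2 - (k - uphalf n)] into [n - k]. *)
have half_sum : (n./2 + uphalf n)%N = n.
  by rewrite addnC uphalf_half -addnA addnn odd_double_half.
by rewrite subzn //= subnBA // half_sum -mulr_natr natz.
Qed.
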